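(* Let $0\le l<k\le n$ be integers, let $\Omega\subset\mathbb{R}^n$ be a $C^1$ bounded domain with outer unit normal $\nu$ on $\partial\Omega$, let $f\in C^0(\overline{\Omega})$ be a positive function and $\varphi\in C^0(\partial\Omega)$. Let $u\in C^2(\Omega)\cap C^1(\overline{\Omega})$ be a $k$-admissible solution of $$\frac{\sigma_k(D^2u)}{\sigma_l(D^2u)} = f(x) \ \text{ in } \Omega, \qquad u_\nu = -u + \varphi(x) \ \text{ on } \partial\Omega.$$ Then $$\sup_\Omega|u|\le M_0,$$ where $M_0$ is a constant depending only on $n$, $k$, $l$, $\mathrm{diam}(\Omega)$, $\max_{\partial\Omega}|\varphi|$ and $\sup_\Omega f$.
   Context: For $\lambda\in\mathbb{R}^n$, $\sigma_j(\lambda)=\sum_{1\le i_1<\cdots<i_j\le n}\lambda_{i_1}\cdots\lambda_{i_j}$ and $\sigma_0=1$. For a symmetric matrix $A$, $\sigma_j(A)=\sigma_j(\lambda(A))$, where $\lambda(A)$ is the vector of eigenvalues of $A$. $\Gamma_k=\{\lambda\in\mathbb{R}^n:\sigma_i(\lambda)>0 \text{ for all } 1\le i\le k\}$. A solution $u$ is $k$-admissible if $\lambda(D^2u(x))\in\Gamma_k$ for every $x\in\Omega$. *)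

(* Defs.v *)
From HB Require Import structures.
From mathcomp Require Import all_boot all_order all_algebra.
From mathcomp Require Import all_classical all_reals all_analysis.

Set Implicit Arguments.
Unset Strict Implicit.
Unset Printing Implicit Defensive.

Import Order.TTheory GRing.Theory Num.Theory.
Import numFieldNormedType.Exports.

Local Open Scope classical_set_scope.
Local Open Scope ring_scope.

Section Euclidean.
Variables (R : realType) (n : nat).
Implicit Types x y : 'rV[R]_n.

Definition edot x y : R := \sum_(i < n) x 0 i * y 0 i.

(* The library norm `|x| on 'rV[R]_n is the sup norm: it induces the same
   topology, but lengths and diameters below are Euclidean. *)
Definition enorm x : R := Num.sqrt (edot x x).

Definition ediam (A : set 'rV[R]_n) : R :=
  sup [set enorm (p.1 - p.2) | p in A `*` A].

Definition boundary (A : set 'rV[R]_n) : set 'rV[R]_n :=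
  closure A `\` interior A.

End Euclidean.

Section Sigma.
Variables (R : realType) (n : nat).

Definition sigma (j : nat) (lam : 'rV[R]_n) : R :=
  \sum_(I : {set 'I_n} | #|I| == j) \prod_(i in I) lam 0 i.

(* The eigenvalues counted with multiplicity, in some order; they exist for
   every symmetric matrix. The ordering is irrelevant, as sigma and Gamma are
   invariant under permutations of the coordinates. *)
Definition eigenvalues (A : 'M[R]_n) : 'rV[R]_n :=
  xget 0 [set lam : 'rV[R]_n |
    char_poly A = \prod_(i < n) ('X - (lam 0 i)%:P)].

Definition sigma_mx (j : nat) (A : 'M[R]_n) : R := sigma j (eigenvalues A).

Definition Gamma (k : nat) : set 'rV[R]_n :=
  [set lam | forall i, (1 <= i <= k)%N -> 0 < sigma i lam].

End Sigma.

Section Calculus.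
Variables (R : realType) (n : nat).
Implicit Types (u : 'rV[R]_n -> R) (U : set 'rV[R]_n).

Definition partial (i : 'I_n) u : 'rV[R]_n -> R := 'D_(delta_mx 0 i) u.

Definition grad u (x : 'rV[R]_n) : 'rV[R]_n := \row_(i < n) partial i u x.

Definition hessian u (x : 'rV[R]_n) : 'M[R]_n :=
  \matrix_(i < n, j < n) partial j (partial i u) x.

(* C1_on and C2_on are meant for open sets U. *)
Definition C1_on U u : Prop :=
  forall x, U x ->
    differentiable u x /\ forall i, {for x, continuous (partial i u)}.

Definition C2_on U u : Prop :=
  C1_on U u /\ forall i, C1_on U (partial i u).

(* C^1 up to the boundary: u is continuous on the closure of U, C^1 in U, and
   its gradient has a continuous extension G to the closure of U. *)
Definition C1_closure U u : Prop :=
  [/\ {within closure U, continuous u},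
      C1_on U u &
      exists2 G : 'rV[R]_n -> 'rV[R]_n,
        {within closure U, continuous G} & {in U, G =1 grad u}].

(* Value at a point of the closure of U of the continuous extension of the
   gradient. *)
Definition grad_closure U u (x : 'rV[R]_n) : 'rV[R]_n :=
  lim (grad u @ within U (nbhs x)).

Definition normal_derivative U (nu : 'rV[R]_n -> 'rV[R]_n) u
    (x : 'rV[R]_n) : R :=
  edot (grad_closure U u x) (nu x).

Definition admissible (k : nat) U u : Prop :=
  forall x, U x -> Gamma k (eigenvalues (hessian u x)).

End Calculus.

Section Domains.
Variables (R : realType) (n : nat).
Implicit Types (Omega : set 'rV[R]_n) (x : 'rV[R]_n).

Definition C1_defining_function Omega x (rho : 'rV[R]_n -> R) : Prop :=
  exists U : set 'rV[R]_n,
    [/\ open_nbhs x U,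
        C1_on U rho,
        forall y, U y -> grad rho y != 0,
        Omega `&` U = [set y | rho y < 0] `&` U &
        boundary Omega `&` U = [set y | rho y = 0] `&` U].

Definition bounded_C1_domain Omega : Prop :=
  [/\ Omega !=set0, open Omega, connected Omega, bounded_set Omega &
      forall x, boundary Omega x -> exists rho, C1_defining_function Omega x rho].

Definition outer_unit_normal Omega (nu : 'rV[R]_n -> 'rV[R]_n) : Prop :=
  forall x, boundary Omega x ->
    exists2 rho, C1_defining_function Omega x rho &
      nu x = (enorm (grad rho x))^-1 *: grad rho x.

End Domains.

(* Main.v *)
Require Import Defs.
From HB Require Import structures.
From mathcomp Require Import all_boot all_order all_algebra.
From mathcomp Require Import all_classical all_reals all_analysis.
From mathcomp Require Import ring lra.
Import Order.TTheory GRing.Theory Num.Theory.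
Import numFieldNormedType.Exports.
Local Open Scope classical_set_scope.
Local Open Scope ring_scope.

(** The estimate follows from the maximum principle, with a boundary condition
    that controls [u] itself as soon as the sign of its normal derivative is
    known.

    Upper bound. An admissible function has positive Laplacian, so [u] cannot
    have an interior maximum ([no_interior_max]) and attains its maximum over
    the closure at a boundary point [x]. There the normal derivative is
    nonnegative ([normal_derivative_ge0_at_max]), and the condition
    [u_nu = - u + phi] gives [u x <= phi x].

    Lower bound. Fix [c] in the domain and compare [u] with the paraboloid
    [a / 2 * |y - c|^2], where [a] is chosen so large in terms of [sup f] that
    [sigma k / sigma l > sup f] as soon as all eigenvalues are at least [a]
    ([sigma_ratio_gt]). At an interior minimum of the difference the Hessian
    of [u] dominates [a] times the identity, contradicting the equation
    ([no_interior_min]). The minimum is thus attained at a boundary point [x],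
    where [u_nu <= a * (x - c).nu <= a * d] with [d] the diameter
    ([normal_derivative_le_at_min]); the boundary condition then bounds [u x]
    from below by [- max |phi| - a * d], and passing from [x] to any other
    point costs at most [a / 2 * d^2].

    The Hessian is tested on lines, through its quadratic form. Positivity of
    [sigma 1] guarantees that its eigenvalues are real ([eigenvaluesP]), and a
    lower bound on the form passes to them through eigenvectors
    ([char_poly_root_ge]). *)

(** * Euclidean inner product *)

Lemma edotC {R : realType} {n} (x y : 'rV[R]_n) : edot x y = edot y x.
Proof. by apply: eq_bigr => i _; rewrite mulrC. Qed.

Lemma edotDl {R : realType} {n} (x y z : 'rV[R]_n) :
  edot (x + y) z = edot x z + edot y z.
Proof.
by rewrite -big_split; apply: eq_bigr => i _ /=; rewrite mxE mulrDl.
Qed.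

Lemma edotZl {R : realType} {n} (a : R) (x y : 'rV[R]_n) :
  edot (a *: x) y = a * edot x y.
Proof. by rewrite mulr_sumr; apply: eq_bigr => i _; rewrite mxE mulrA. Qed.

Lemma edotDr {R : realType} {n} (x y z : 'rV[R]_n) :
  edot z (x + y) = edot z x + edot z y.
Proof. by rewrite edotC edotDl ![edot _ z]edotC. Qed.

Lemma edotZr {R : realType} {n} (a : R) (x y : 'rV[R]_n) :
  edot x (a *: y) = a * edot x y.
Proof. by rewrite edotC edotZl edotC. Qed.

Lemma edotxx_ge0 {R : realType} {n} (x : 'rV[R]_n) : 0 <= edot x x.
Proof. by apply: sumr_ge0 => i _; rewrite -expr2 sqr_ge0. Qed.

Lemma edotxx_gt0 {R : realType} {n} (x : 'rV[R]_n) : x != 0 -> 0 < edot x x.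
Proof.
move=> x0; rewrite lt_def edotxx_ge0 andbT; apply: contra x0 => /eqP xx0.
apply/eqP/rowP => i; rewrite mxE; apply/eqP; rewrite -sqrf_eq0 expr2.
move/eqP: xx0; rewrite psumr_eq0 => [/allP/(_ i (mem_index_enum i))//|j _].
by rewrite -expr2 sqr_ge0.
Qed.

Lemma enorm_sqr {R : realType} {n} (x : 'rV[R]_n) : enorm x ^+ 2 = edot x x.
Proof. by rewrite sqr_sqrtr// edotxx_ge0. Qed.

Lemma enorm_ge0 {R : realType} {n} (x : 'rV[R]_n) : 0 <= enorm x.
Proof. exact: sqrtr_ge0. Qed.

(** Cauchy-Schwarz against a unit vector: the squared norm of
    [x - (x.v) v] is [|x|^2 - (x.v)^2]. *)
Lemma edot_unit_le {R : realType} {n} (x v : 'rV[R]_n) :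
  edot v v = 1 -> edot x v <= enorm x.
Proof.
move=> v1; have := edotxx_ge0 (x + (- edot x v) *: v).
rewrite edotDl !edotDr !edotZl !edotZr v1 (edotC v x) => h.
apply: le_trans (ler_norm _) _.
rewrite -(@ler_pXn2r _ 2) ?nnegrE ?enorm_ge0//.
rewrite real_normK ?num_real// enorm_sqr; nra.
Qed.

(** The barrier [a / 2 * |y - c|^2] is a parabola along every line. *)
Lemma edot_sqr_line {R : realType} {n} (x c w : 'rV[R]_n) (t : R) :
  edot (x + t *: w - c) (x + t *: w - c) =
  edot (x - c) (x - c) + 2 * t * edot (x - c) w + t ^+ 2 * edot w w.
Proof.
rewrite addrAC; move: (x - c) => y.
by rewrite edotDl !edotDr !edotZl !edotZr (edotC w); ring.
Qed.

(** * Elementary symmetric functions of large eigenvalues *)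

Lemma sigma1E {R : realType} {n} (lam : 'rV[R]_n) :
  sigma 1 lam = \sum_(i < n) lam 0 i.
Proof.
rewrite /sigma.
transitivity (\sum_(I in [set [set i] | i in [set: 'I_n]]%SET)
   \prod_(i in I) lam 0 i).
  apply: eq_bigl => I; apply/cards1P/imsetP => [[i ->]|[i _ ->]]; exists i => //.
rewrite big_imset/=; last by move=> i j _ _ /set1_inj.
by apply: eq_big => i; rewrite ?inE// => _; rewrite big_set1.
Qed.

(** The default value of [eigenvalues] is the zero vector, whose [sigma 1]
    vanishes: membership in [Gamma k] therefore certifies that the
    characteristic polynomial splits over the reals. *)
Lemma eigenvaluesP {R : realType} {n k} (A : 'M[R]_n) :
  (0 < k)%N -> Gamma k (eigenvalues A) ->
  char_poly A = \prod_(i < n) ('X - (eigenvalues A 0 i)%:P).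
Proof.
move=> k0 /(_ 1%N); rewrite k0 => /(_ isT); rewrite /eigenvalues.
case: xgetP => [lam _ //|_].
by rewrite sigma1E big1 ?ltxx// => i _; rewrite mxE.
Qed.

Lemma mxtrace_char_poly_roots {R : realType} {n} (A : 'M[R]_n) (lam : 'rV[R]_n) :
  char_poly A = \prod_(i < n) ('X - (lam 0 i)%:P) ->
  \tr A = \sum_(i < n) lam 0 i.
Proof.
case: n A lam => [|n] A lam; first by rewrite /mxtrace !big_ord0.
move=> h; have := @char_poly_trace _ _ A isT; rewrite h.
pose s := [seq lam 0 i | i <- enum 'I_n.+1].
have ss : size s = n.+1 by rewrite size_map size_enum_ord.
have := @coefPn_prod_XsubC _ s; rewrite ss.
have -> : \prod_(p <- s) ('X - p%:P) = \prod_(i < n.+1) ('X - (lam 0 i)%:P).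
  by rewrite big_map big_enum.
have -> : \sum_(p <- s) p = \sum_(i < n.+1) lam 0 i by rewrite big_map big_enum.
by move=> -> // /oppr_inj.
Qed.

(** Evaluate the quadratic form at an eigenvector. *)
Lemma char_poly_root_ge {R : realType} {n} (A : 'M[R]_n) (a lam : R) :
  (forall w, a * edot w w <= edot (w *m A) w) ->
  root (char_poly A) lam -> a <= lam.
Proof.
move=> Aa; rewrite -eigenvalue_root_char => /eigenvalueP[w wA w0].
by have := Aa w; rewrite wA edotZl ler_pM2r// edotxx_gt0.
Qed.

Lemma exists_superset_card {T : finType} (A : {set T}) (k : nat) :
  (#|A| <= k <= #|T|)%N -> exists2 B : {set T}, A \subset B & #|B| = k.
Proof.
move=> /andP[Ak kT].
pose D := [set x in take (k - #|A|) (enum (~: A))]%SET.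
exists (A :|: D)%SET; first exact: finset.subsetUl.
have dis : (A :&: D = finset.set0)%SET.
  apply/setP => x; rewrite !inE; case xA: (x \in A) => //=.
  by apply/negP => /mem_take; rewrite mem_enum inE xA.
rewrite cardsU dis cards0 subn0 cardsE.
have /card_uniqP -> : uniq (take (k - #|A|) (enum (~: A))).
  by rewrite take_uniq// enum_uniq.
by rewrite size_takel ?subnKC// -cardE leq_subLR cardsC.
Qed.

Lemma prod_ge_expM {R : realType} {n} {lam : 'rV[R]_n} {a : R} {L K : {set 'I_n}} :
  0 <= a -> (forall i, a <= lam 0 i) -> L \subset K ->
  a ^+ (#|K| - #|L|) * \prod_(i in L) lam 0 i <= \prod_(i in K) lam 0 i.
Proof.
move=> a0 lama LK; rewrite [leRHS](big_setID L)/= (finset.setIidPr LK) mulrC.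
rewrite ler_wpM2l//; first by apply: prodr_ge0 => i _; exact: le_trans (lama i).
rewrite -cardsDS// -prodr_const; apply: ler_prod => i _; rewrite a0.
exact: lama.
Qed.

(** Extend each [l]-subset [L] to some [k]-subset [K]: the product over [K]
    is at least [a ^+ (k - l)] times the product over [L], and there are at
    most [2 ^+ n] subsets [L]. *)
Lemma sigma_ge_expM {R : realType} {n} {lam : 'rV[R]_n} {a : R} {l k : nat} :
  0 <= a -> (forall i, a <= lam 0 i) -> (l <= k <= n)%N ->
  a ^+ (k - l) * sigma l lam <= 2 ^+ n * sigma k lam.
Proof.
move=> a0 lama /andP[lk kn].
have prod0 (I : {set 'I_n}) : 0 <= \prod_(i in I) lam 0 i.
  by apply: prodr_ge0 => i _; exact: le_trans (lama i).
have sig0 : 0 <= sigma k lam by exact: sumr_ge0.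
rewrite mulr_sumr.
apply: (@le_trans _ _ (\sum_(L : {set 'I_n} | #|L| == l) sigma k lam)).
  apply: ler_sum => L /eqP Ll.
  have [|K LK Kk] := @exists_superset_card _ L k; first by rewrite Ll lk card_ord.
  rewrite -Kk -Ll; apply: (le_trans (prod_ge_expM a0 lama LK)).
  rewrite /sigma (bigD1 K)/= ?Kk// lerDl.
  exact: sumr_ge0.
rewrite sumr_const -[leLHS]mulr_natl ler_wpM2r// -natrX ler_nat.
apply: leq_trans (max_card _) _.
by rewrite -cardsT -powersetT card_powerset cardsT card_ord.
Qed.

(** The form in which the growth of [sigma k / sigma l] is used: the threshold
    [2 ^+ n * F + 1] is at least 1, so its power of exponent [k - l > 0] still
    exceeds [2 ^+ n * F]. *)
Lemma sigma_ratio_gt {R : realType} {n} (lam : 'rV[R]_n) (F : R) (l k : nat) :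
  0 <= F -> (forall i, 2 ^+ n * F + 1 <= lam 0 i) -> (l < k <= n)%N ->
  F < sigma k lam / sigma l lam.
Proof.
move=> F0 lama /andP[lk kn].
set a : R := 2 ^+ n * F + 1.
have p0 : 0 < 2 ^+ n :> R by rewrite exprn_gt0.
have a1 : 1 <= a by rewrite lerDr mulr_ge0// ltW.
have a0 : 0 <= a by exact: le_trans a1.
have sl0 : 0 < sigma l lam.
  have [|L _ Ll] := @exists_superset_card _ (finset.set0 : {set 'I_n}) l.
    by rewrite cards0 card_ord (leq_trans (ltnW lk)).
  rewrite /sigma (bigD1 L)/= ?Ll//; apply: ltr_pwDl.
    by apply: prodr_gt0 => i _; apply: lt_le_trans (lama i); exact: lt_le_trans a1.
  apply: sumr_ge0 => I _; apply: prodr_ge0 => i _; exact: le_trans (lama i).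
rewrite ltr_pdivlMr// -(ltr_pM2l p0).
have lkn : (l <= k <= n)%N by rewrite (ltnW lk).
apply: lt_le_trans (sigma_ge_expM a0 lama lkn).
rewrite mulrA ltr_pM2r//; apply: (@lt_le_trans _ _ a); first by rewrite ltrDl.
by rewrite -[leLHS]expr1 ler_weXn2l// subn_gt0.
Qed.

(** * Second-order conditions along lines *)

(** Second derivative test against a parabola: [g - b t - a t^2 / 2] has a
    local minimum at 0, so its derivative vanishes there; were its second
    derivative negative, it would decrease to the right of 0. *)
Lemma second_derivative_ge {R : realType} (g g' : R -> R) (e a b c : R) :
  0 < e -> (forall t, `|t| < e -> is_derive (t : R) 1 g (g' t)) ->
  is_derive (0 : R) 1 g' c ->
  (forall t, `|t| < e -> g 0 + b * t + a / 2 * t ^+ 2 <= g t) ->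
  a <= c.
Proof.
move=> e0 dg dg' h.
pose q : R -> R := g - b *: id - (a / 2) *: (id ^+ 2).
pose q' : R -> R := g' - cst b - a *: id.
have dq t : `|t| < e -> is_derive (t : R) (1 : R) q (q' t).
  move=> te; have dgt := dg _ te.
  apply: is_derive_eq; rewrite /q' /cst !fctE /= expr1.
  by rewrite /GRing.scale/=; field.
have qmin t : `|t| < e -> q 0 <= q t.
  move=> te; have := h _ te; rewrite /q !fctE /GRing.scale/= => ?.
  by rewrite expr0n/= !mulr0; lra.
have inE' t : (t \in `]-e, e[) = (`|t| < e) by rewrite in_itv/= ltr_norml.
have e0' : `|0 : R| < e by rewrite normr0.
have q'0 : q' 0 = 0.
  have d0 := dq _ e0'.
  have /(@derive_val _ _ _ _ _ _ _) <- := d0.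
  have dm : is_derive (0 : R) (1 : R) q 0.
    apply: (@derive1_at_min _ _ (- e) e) => [|t|| t]; rewrite ?inE'//.
    - by move: e0; lra.
    - by move=> te; case: (dq _ te).
    - exact: qmin.
  exact: (@derive_val _ _ _ _ _ _ _ dm).
have dq' : is_derive (0 : R) (1 : R) q' (c - a).
  by apply: is_derive_eq; rewrite /GRing.scale/= subr0 mulr1.
rewrite leNgt; apply/negP => ca.
have [r r0 Hr] : exists2 r, 0 < r & forall t, 0 < t < r -> q' t < 0.
  have [/cvg_ex[/= m hm] dv] := dq'.
  have := hm; have -> : m = c - a by rewrite -dv; apply/esym/cvg_lim.
  move=> /cvgr_lt /(_ 0); rewrite subr_lt0 => /(_ ca).
  case=> r /= r0 Hr; exists r => // t /andP[t0 tr].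
  have := Hr t; rewrite /ball_/= sub0r normrN gtr0_norm// => /(_ tr).
  rewrite gt_eqF// => /(_ isT).
  by rewrite q'0 subr0 addr0 /GRing.scale/= mulr1 pmulr_rlt0// invr_gt0.
(* A point at which both the sign of [q'] and the bounds on [g] are known. *)
pose s := Num.min r e / 2.
have [s0 sr se] : [/\ 0 < s, s < r & s < e].
  by rewrite /s; case: (leP r e) => ?; split; lra.
have lt_e t : 0 <= t <= s -> `|t| < e.
  by move=> /andP[t0 ts]; rewrite ger0_norm// (le_lt_trans ts).
have [||t] := @MVT _ q q' 0 s s0.
- by move=> t; rewrite in_itv/= => /andP[t0 ts]; apply/dq/lt_e; rewrite !ltW.
- apply: derivable_within_continuous => t; rewrite in_itv/= => ts.
  by case: (dq _ (lt_e _ ts)).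
rewrite in_itv/= subr0 => /andP[t0 ts] Hm.
have : q' t * s < 0 by rewrite nmulr_rlt0// Hr// t0 (lt_trans ts).
rewrite -Hm subr_lt0 ltNge qmin// lt_e// lexx ltW//.
Qed.

Lemma line_cvg {R : realType} {n} (x w : 'rV[R]_n) (t : R) :
  (fun s : R => x + s *: w) @ t --> x + t *: w.
Proof. by apply: cvgD; [exact: cvg_cst | apply: cvgZr_tmp; exact: cvg_id]. Qed.

Lemma near_line_in_open {R : realType} {n} (U : set 'rV[R]_n) (x w : 'rV[R]_n) :
  open U -> U x ->
  exists2 e : R, 0 < e & forall t : R, `|t| < e -> U (x + t *: w).
Proof.
move=> oU Ux; have := line_cvg x w (0 : R).
rewrite scale0r addr0 => /(_ U (open_nbhs_nbhs (conj oU Ux))).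
move=> /nbhs_ballP[e /= e0 eU]; exists e => // t te; apply: eU.
by rewrite -ball_normE /= sub0r normrN.
Qed.

Lemma is_derive_line {R : realType} {n} (u : 'rV[R]_n -> R) (x w : 'rV[R]_n) (t : R) :
  differentiable u (x + t *: w) ->
  is_derive t (1 : R) (fun s => u (x + s *: w)) (edot (grad u (x + t *: w)) w).
Proof.
move=> du.
pose l := cst x + ( *:%R ^~ w).
have dl : is_diff t l (0 + ( *:%R ^~ w)) by exact: is_diffD.
have dul : is_diff t (u \o l) ('d u (x + t *: w) \o (0 + ( *:%R ^~ w))).
  by apply: is_diff_comp; exact/differentiableP.
have -> : (fun s : R => u (x + s *: w)) = u \o l by [].
apply: DeriveDef; first by apply/derivable1_diffP; case: dul.
rewrite deriveE; last by case: dul.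
rewrite (diff_val (f := u \o l)) /= add0r scale1r.
move: (x + t *: w) du => y du {l dl dul}.
rewrite {1}(row_sum_delta w) linear_sum; apply: eq_bigr => i _.
by rewrite linearZ /= mxE /partial deriveE// mulrC.
Qed.

(** The Hessian appears with [w] on the left because its rows are the
    gradients of the partial derivatives. *)
Lemma is_derive_line_grad {R : realType} {n} (u : 'rV[R]_n -> R) (x w : 'rV[R]_n) :
  (forall i, differentiable (partial i u) x) ->
  is_derive (0 : R) (1 : R) (fun s => edot (grad u (x + s *: w)) w)
    (edot (w *m hessian u x) w).
Proof.
move=> du.
have -> : (fun s : R => edot (grad u (x + s *: w)) w) =
    \sum_(i < n) (w 0 i *: (fun s => partial i u (x + s *: w))).
  apply/funext => s; rewrite fct_sumE; apply: eq_bigr => i _.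
  by rewrite mxE mulrC.
have -> : edot (w *m hessian u x) w =
    \sum_(i < n) (w 0 i *: edot (grad (partial i u) x) w).
  rewrite /edot.
  under eq_bigr do rewrite mxE mulr_suml.
  rewrite exchange_big/=; apply: eq_bigr => i _.
  rewrite scaler_sumr; apply: eq_bigr => j _.
  by rewrite !mxE /GRing.scale/= mulrA.
apply: is_derive_sum => i; apply: is_deriveZ.
have := is_derive_line (partial i u) x w 0; rewrite scale0r addr0; exact.
Qed.

(** Touching [u] from below along one line by a parabola bounds the Hessian in
    that direction. The slope [b] is left free: at an extremum of [u - q] it
    is the slope of [q]. *)
Lemma hessian_ge_along {R : realType} {n} (U : set 'rV[R]_n) (u : 'rV[R]_n -> R)
    (x w : 'rV[R]_n) (a b : R) :
  open U -> C2_on U u -> U x ->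
  (forall t, U (x + t *: w) -> u x + b * t + a / 2 * t ^+ 2 <= u (x + t *: w)) ->
  a <= edot (w *m hessian u x) w.
Proof.
move=> oU [u1 u2] Ux h; have [e e0 He] := near_line_in_open U x w oU Ux.
apply: (second_derivative_ge (fun t => u (x + t *: w))
  (fun t => edot (grad u (x + t *: w)) w) e a b) => //.
- by move=> t te; apply: is_derive_line; case: (u1 _ (He _ te)).
- by apply: is_derive_line_grad => i; case: (u2 i _ Ux).
- by move=> t /He /h; rewrite scale0r addr0.
Qed.

Lemma hessian_le_along {R : realType} {n} (U : set 'rV[R]_n) (u : 'rV[R]_n -> R)
    (x w : 'rV[R]_n) (a b : R) :
  open U -> C2_on U u -> U x ->
  (forall t, U (x + t *: w) -> u (x + t *: w) <= u x + b * t + a / 2 * t ^+ 2) ->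
  edot (w *m hessian u x) w <= a.
Proof.
move=> oU [u1 u2] Ux h; have [e e0 He] := near_line_in_open U x w oU Ux.
rewrite -lerN2.
apply: (second_derivative_ge (- (fun t => u (x + t *: w)))
  (- (fun t => edot (grad u (x + t *: w)) w)) e (- a) (- b)) => //.
- move=> t te; apply: is_deriveN; apply: is_derive_line.
  by case: (u1 _ (He _ te)).
- by apply: is_deriveN; apply: is_derive_line_grad => i; case: (u2 i _ Ux).
- move=> t /He /h.
  change (u (x + t *: w) <= u x + b * t + a / 2 * t ^+ 2 ->
    - u (x + 0 *: w) + - b * t + - a / 2 * t ^+ 2 <= - u (x + t *: w)).
  rewrite scale0r addr0; lra.
Qed.

(** * Suprema over compact sets and the diameter *)

Lemma edot_cvg {R : realType} {n} {T : Type} {F : set_system T} {FF : Filter F}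
    (f g : T -> 'rV[R]_n) (a b : 'rV[R]_n) :
  f @ F --> a -> g @ F --> b -> (fun x => edot (f x) (g x)) @ F --> edot a b.
Proof.
move=> fa gb; apply: cvg_big => [|i _]; first exact: add_continuous.
by apply: cvgM; [exact: (continuous_cvg _ (@coord_continuous _ _ _ 0 i a) fa)
  | exact: (continuous_cvg _ (@coord_continuous _ _ _ 0 i b) gb)].
Qed.

Lemma enorm_cvg {R : realType} {n} {T : Type} {F : set_system T} {FF : Filter F}
    (f : T -> 'rV[R]_n) (a : 'rV[R]_n) :
  f @ F --> a -> (fun x => enorm (f x)) @ F --> enorm a.
Proof.
move=> fa; apply: (continuous_cvg _ (@sqrt_continuous _ (edot a a))).
exact: edot_cvg.
Qed.

Lemma compact_closure_bounded {R : realType} {n} (A : set 'rV[R]_n) :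
  bounded_set A -> compact (closure A).
Proof.
move=> [M [_ /(_ (M + 1))]]; rewrite ltrDl ltr01 => /(_ isT) AM.
have clM : closed [set x : 'rV[R]_n | `|x| <= M + 1].
  exact: preimage_closed (fun x _ => @norm_continuous _ _ x) (@closed_le _ (M + 1)).
have sub : closure A `<=` [set x : 'rV[R]_n | `|x| <= M + 1].
  by rewrite [X in _ `<=` X]((closure_id _).1 clM); apply: closure_subset => x /AM.
apply: bounded_closed_compact; last exact: closed_closure.
exists (M + 1); split; first exact: num_real.
by move=> N MN x /sub /= xM; rewrite (le_trans xM)// ltW.
Qed.

Lemma le_sup_image_compact {R : realType} {n} (K A : set 'rV[R]_n)
    (g : 'rV[R]_n -> R) (x : 'rV[R]_n) :
  compact K -> {within K, continuous g} -> A `<=` K -> A x ->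
  g x <= sup [set g y | y in A].
Proof.
move=> cK cg AK Ax; have := continuous_compact cg cK.
move=> /compact_has_sup[|_ [M HM]]; first by exists (g x); exists x => //; exact: AK.
apply: ub_le_sup; last by exists x.
by exists M => _ [y Ay <-]; apply: HM; exists y => //; exact: AK.
Qed.

Lemma has_sup_enormB {R : realType} {n} (A : set 'rV[R]_n) :
  A !=set0 -> compact A -> has_sup [set enorm (p.1 - p.2) | p in A `*` A].
Proof.
move=> [x Ax] cA; apply: compact_has_sup.
  by exists (enorm (x - x)); exists (x, x).
apply: continuous_compact; last exact: compact_setX.
apply: continuous_subspaceT => p; apply: enorm_cvg.
by apply: cvgB; [exact: cvg_fst | exact: cvg_snd].
Qed.

(** The diameter is a supremum over [A] itself; letting [x] range over the
    closure is what allows boundary points. *)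
Lemma enormB_le_ediam {R : realType} {n} (A : set 'rV[R]_n) (x y : 'rV[R]_n) :
  bounded_set A -> closure A x -> A y -> enorm (x - y) <= ediam A.
Proof.
move=> bA Ax Ay.
have hA : has_ubound [set enorm (p.1 - p.2) | p in A `*` A].
  have [|_ [M HM]] := has_sup_enormB _ _ (compact_closure_bounded _ bA).
    by exists x.
  exists M => _ [p [p1 p2] <-]; apply: HM; exists p => //.
  by split; exact: subset_closure.
have clD : closed [set z | enorm (z - y) <= ediam A].
  have cD : continuous (fun z : 'rV[R]_n => enorm (z - y)).
    move=> z; have dz : (fun z : 'rV[R]_n => z - y) @ z --> z - y.
      by apply: (cvgB (F := nbhs z)); [exact: cvg_id | exact: cvg_cst].
    exact: enorm_cvg dz.
  exact: (preimage_closed (fun z _ => cD z) (@closed_le _ (ediam A))).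
suff : closure A `<=` [set z | enorm (z - y) <= ediam A] by apply.
rewrite [X in _ `<=` X]((closure_id _).1 clD); apply: closure_subset => z Az.
by apply: (ub_le_sup hA); exists (z, y).
Qed.

(** * The normal derivative as a limit of difference quotients *)

(** A defining function has derivative [- |grad rho| < 0] at [x] in the
    direction [- nu x], so it is negative on a short segment leaving [x] in
    that direction. *)
Lemma outer_unit_normal_inward {R : realType} {n} (Omega : set 'rV[R]_n)
    (nu : 'rV[R]_n -> 'rV[R]_n) (x : 'rV[R]_n) :
  outer_unit_normal Omega nu -> boundary Omega x ->
  edot (nu x) (nu x) = 1 /\ \forall t \near 0^'+, Omega (x - t *: nu x).
Proof.
move=> onu bx; have [rho [U [[oU Ux] rho1 rho0 OmU bU]] nux] := onu _ bx.
have g0 : 0 < edot (grad rho x) (grad rho x) by exact/edotxx_gt0/rho0.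
have e0 : 0 < enorm (grad rho x) by rewrite sqrtr_gt0.
have nn : edot (nu x) (nu x) = 1.
  rewrite nux edotZl edotZr -enorm_sqr; field; exact: lt0r_neq0.
have ng : 0 < edot (grad rho x) (nu x).
  by rewrite nux edotZr mulr_gt0// invr_gt0.
split=> //.
have rx : rho x = 0 by have : (boundary Omega `&` U) x by []; rewrite bU => -[].
have := is_derive_line rho x (- nu x) 0.
rewrite scale0r addr0 => /(_ (rho1 _ Ux).1).
have -> : edot (grad rho x) (- nu x) = - edot (grad rho x) (nu x).
  by rewrite -scaleN1r edotZr mulN1r.
move=> [/cvg_ex[/= m hm] dv].
have := hm; have -> : m = - edot (grad rho x) (nu x).
  by rewrite -dv; apply/esym/cvg_lim.
move=> /cvgr_lt /(_ 0); rewrite oppr_lt0 => /(_ ng) [r /= r0 Hr].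
have [r' r'0 rU] := near_line_in_open U x (- nu x) oU Ux.
near=> t; have t0 : 0 < t by near: t; exact: nbhs_right_gt.
have tr : `|t| < r by rewrite gtr0_norm//; near: t; exact: nbhs_right_lt.
have tr' : `|t| < r' by rewrite gtr0_norm//; near: t; exact: nbhs_right_lt.
have := Hr t; rewrite /ball_/= sub0r normrN => /(_ tr).
rewrite gt_eqF// => /(_ isT).
rewrite scale0r !addr0 rx subr0 [t%:A]mulr1 [_ *: rho _]mulrC pmulr_llt0 ?invr_gt0//.
move=> rt; have := rU _ tr'; rewrite scalerN in rt * => Ut.
have : ([set y | rho y < 0] `&` U) (x - t *: nu x) by [].
by rewrite -OmU => -[].
Unshelve. all: by end_near. Qed.

Lemma grad_closure_cvg {R : realType} {n} (U : set 'rV[R]_n) (u : 'rV[R]_n -> R)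
    (x : 'rV[R]_n) :
  C1_closure U u -> closure U x ->
  grad u @ within U (nbhs x) --> grad_closure U u x.
Proof.
move=> [_ _ [G cG Gu]] clx.
have PF : ProperFilter (within U (nbhs x)) by exact: within_nbhs_proper.
have GG : grad u @ within U (nbhs x) --> G x.
  move/subspace_continuousP : cG => /(_ _ clx) cG.
  have GU : G @ within U (nbhs x) --> G x.
    apply: cvg_trans cG; apply: cvg_app; apply: within_subset.
    exact: subset_closure.
  apply: cvg_trans GU; apply: near_eq_cvg.
  by rewrite near_withinE; apply: nearW => y Uy; apply: Gu; rewrite inE.
by rewrite /grad_closure (cvg_lim _ GG)//; exact: norm_hausdorff.
Qed.

(** Ties the boundary gradient, defined as a limit from inside, to difference
    quotients at the boundary point: by the mean value theorem the quotient
    is a directional derivative at an interior point of the segment. *)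
Lemma normal_quotient_cvg {R : realType} {n} (U : set 'rV[R]_n)
    (u : 'rV[R]_n -> R) (x v : 'rV[R]_n) :
  C1_closure U u -> closure U x -> (\forall t \near 0^'+, U (x - t *: v)) ->
  (fun t => (u x - u (x - t *: v)) / t) @ 0^'+ --> edot (grad_closure U u x) v.
Proof.
move=> Cu clx Uv.
have gc := grad_closure_cvg _ _ _ Cu clx.
have PF : ProperFilter (within U (nbhs x)) by exact: within_nbhs_proper.
have gcv : (fun y => edot (grad u y) v) @ within U (nbhs x) -->
    edot (grad_closure U u x) v by apply: edot_cvg => //; exact: cvg_cst.
move/cvgrPdist_lt : gcv => ec; apply/cvgrPdist_lt => e e0.
have [d /= d0 Hd] : exists2 d, 0 < d & forall t, 0 < t < d -> U (x - t *: v) /\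
    `|edot (grad_closure U u x) v - edot (grad u (x - t *: v)) v| < e.
  have hx := line_cvg x (- v) (0 : R); rewrite scale0r addr0 in hx.
  have [r /= r0 Hr] := hx _ (ec _ e0).
  have [r' /= r'0 Hr'] := Uv.
  exists (Num.min r r'); first by rewrite lt_min r0.
  move=> t; rewrite lt_min => /and3P[t0 tr tr'].
  have Ut : U (x - t *: v).
    by apply: Hr' => //; rewrite /ball_/= sub0r normrN gtr0_norm.
  split=> //; have := Hr t; rewrite /ball_/= sub0r normrN gtr0_norm// scalerN.
  exact.
near=> t.
have t0 : 0 < t by near: t; exact: nbhs_right_gt.
have td : t < d by near: t; exact: nbhs_right_lt.
have [cu u1 _] := Cu.
pose g s := u (x + s *: - v).
have gd s : s \in `]0, t[ ->
    is_derive (s : R) (1 : R) g (edot (grad u (x + s *: - v)) (- v)).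
  rewrite in_itv/= => /andP[s0 st]; apply: is_derive_line.
  have [|Us _] := Hd s; first by rewrite s0 (lt_trans st).
  by rewrite scalerN; case: (u1 _ Us).
have gcont : {within `[0, t], continuous g}.
  apply/subspace_continuousP => s; rewrite /= in_itv/= => /andP[s0 st].
  have clt z : 0 <= z <= t -> closure U (x + z *: - v).
    move=> /andP[]; rewrite le_eqVlt => /predU1P[<- _|z0 zt].
      by rewrite scale0r addr0.
    apply: subset_closure; rewrite scalerN; apply: (Hd z _).1.
    by rewrite z0 (le_lt_trans zt).
  have cs := (subspace_continuousP _ _).1 cu _ (clt s _).
  apply: (@cvg_comp _ _ _ (fun s : R => x + s *: - v) u _ _ _ _ (cs _)).
    move=> A /(line_cvg x (- v) s) hA; apply: (@filterS _ (nbhs s) _ _ _ _ hA).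
    by move=> z hz; rewrite /= in_itv/= => zt; exact/hz/clt.
  by rewrite s0.
have [s st] := MVT t0 gd gcont.
rewrite /g subr0 scale0r addr0 scalerN => E.
have -> : (u x - u (x - t *: v)) / t = edot (grad u (x - s *: v)) v.
  rewrite -opprB E scalerN -[- v]scaleN1r edotZr; field; exact: lt0r_neq0.
apply: (Hd s _).2; move: st; rewrite in_itv/= => /andP[-> st].
exact: lt_trans td.
Unshelve. all: by end_near. Qed.

Lemma normal_derivative_ge0_at_max {R : realType} {n} (U : set 'rV[R]_n)
    (nu : 'rV[R]_n -> 'rV[R]_n) (u : 'rV[R]_n -> R) (x : 'rV[R]_n) :
  outer_unit_normal U nu -> C1_closure U u -> boundary U x ->
  (forall y, U y -> u y <= u x) -> 0 <= normal_derivative U nu u x.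
Proof.
move=> onu Cu bx umax; have [_ Un] := outer_unit_normal_inward _ _ _ onu bx.
apply: (cvgr_to_ge (normal_quotient_cvg _ _ _ _ Cu bx.1 Un)).
near=> t; have t0 : 0 < t by near: t; exact: nbhs_right_gt.
apply: divr_ge0; last exact: ltW.
by rewrite subr_ge0; apply: umax; near: t.
Unshelve. all: by end_near. Qed.

(** The right-hand side is the normal derivative at [x] of the barrier
    [a / 2 * |y - c|^2]. *)
Lemma normal_derivative_le_at_min {R : realType} {n} (a : R) (U : set 'rV[R]_n)
    (nu : 'rV[R]_n -> 'rV[R]_n) (u : 'rV[R]_n -> R) (x c : 'rV[R]_n) :
  0 <= a -> outer_unit_normal U nu -> C1_closure U u -> boundary U x ->
  (forall y, U y -> u x - a / 2 * edot (x - c) (x - c) <=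
                    u y - a / 2 * edot (y - c) (y - c)) ->
  normal_derivative U nu u x <= a * edot (x - c) (nu x).
Proof.
move=> a0 onu Cu bx umin; have [n1 Un] := outer_unit_normal_inward _ _ _ onu bx.
apply: (cvgr_to_le (normal_quotient_cvg _ _ _ _ Cu bx.1 Un)).
near=> t; have t0 : 0 < t by near: t; exact: nbhs_right_gt.
have Ut : U (x - t *: nu x) by near: t.
rewrite ler_pdivrMr//; have := umin _ Ut.
rewrite -(scaleNr t (nu x)) edot_sqr_line n1.
have : 0 <= a * t ^+ 2 by rewrite mulr_ge0// sqr_ge0.
lra.
Unshelve. all: by end_near. Qed.

(** * The maximum principle and the estimate *)

(** The Laplacian of an admissible function is [sigma 1 > 0], while the trace
    of the Hessian is nonpositive at an interior maximum. *)
Lemma no_interior_max {R : realType} {n} (k : nat) (U : set 'rV[R]_n)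
    (u : 'rV[R]_n -> R) (x : 'rV[R]_n) :
  (0 < k)%N -> open U -> C2_on U u -> U x -> Gamma k (eigenvalues (hessian u x)) ->
  ~ (forall y, U y -> u y <= u x).
Proof.
move=> k0 oU Cu Ux Gx umax.
have : 0 < \tr (hessian u x).
  rewrite (mxtrace_char_poly_roots _ _ (eigenvaluesP _ k0 Gx)) -sigma1E.
  by apply: Gx; rewrite k0.
apply/negP; rewrite -leNgt; apply: sumr_le0 => i _.
have -> : hessian u x i i = edot (delta_mx 0 i *m hessian u x) (delta_mx 0 i).
  rewrite -rowE /edot (bigD1 i)//= big1 => [|j ji].
    by rewrite !mxE !eqxx mulr1 addr0.
  by rewrite !mxE (negPf ji) andbF mulr0.
apply: (hessian_le_along U u x _ 0 0) => // t Ut.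
by rewrite !mul0r !addr0; exact: umax.
Qed.

(** At an interior minimum of [u - a / 2 * |y - c|^2] the Hessian of [u] is at
    least [a] times the identity, so all its eigenvalues are at least [a] and
    the ratio would exceed [F]. This is the comparison principle
    for a quadratic barrier. *)
Lemma no_interior_min {R : realType} {n} (l k : nat) (F : R) (U : set 'rV[R]_n)
    (u : 'rV[R]_n -> R) (x c : 'rV[R]_n) (a := 2 ^+ n * F + 1) :
  (l < k <= n)%N -> 0 <= F -> open U -> C2_on U u -> U x ->
  Gamma k (eigenvalues (hessian u x)) ->
  sigma_mx k (hessian u x) / sigma_mx l (hessian u x) <= F ->
  ~ (forall y, U y -> u x - a / 2 * edot (x - c) (x - c) <=
                      u y - a / 2 * edot (y - c) (y - c)).
Proof.
move=> lkn F0 oU Cu Ux Gx uF umin; move: uF; apply/negP; rewrite -ltNge.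
apply: sigma_ratio_gt => // i.
have k0 : (0 < k)%N by case/andP: (lkn) => lk _; exact: leq_ltn_trans lk.
apply: (char_poly_root_ge (hessian u x)) => [w|]; last first.
  rewrite (eigenvaluesP _ k0 Gx) /root horner_prod (bigD1 i)//=.
  by rewrite hornerXsubC subrr mul0r.
apply: (hessian_ge_along U u x w _ (a * edot (x - c) w)) => // t Ut.
by have := umin _ Ut; rewrite edot_sqr_line -/a; lra.
Qed.

Theorem theorem3p1 (R : realType) :
  exists M0 : nat -> nat -> nat -> R -> R -> R -> R,
  forall (n k l : nat) (Omega : set 'rV[R]_n) (nu : 'rV[R]_n -> 'rV[R]_n)
    (f phi u : 'rV[R]_n -> R),
  (l < k)%N -> (k <= n)%N ->
  bounded_C1_domain Omega ->
  outer_unit_normal Omega nu ->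
  {within closure Omega, continuous f} ->
  (forall x, closure Omega x -> 0 < f x) ->
  {within boundary Omega, continuous phi} ->
  C2_on Omega u ->
  C1_closure Omega u ->
  admissible k Omega u ->
  (forall x, Omega x ->
    sigma_mx k (hessian u x) / sigma_mx l (hessian u x) = f x) ->
  (forall x, boundary Omega x ->
    normal_derivative Omega nu u x = - u x + phi x) ->
  (ereal_sup [set `|u x|%:E | x in Omega] <=
    (M0 n k l (ediam Omega) (sup [set `|phi x| | x in boundary Omega])
       (sup [set f x | x in Omega]))%:E)%E.
Proof.
exists (fun n _ _ d p F =>
  p + (2 ^+ n * F + 1) * d + (2 ^+ n * F + 1) / 2 * d ^+ 2).
move=> n k l Om nu f phi u lk kn [[c Oc] oO _ bO _] onu cf f0 cphi C2u C1u adm eqf bc.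
set d := ediam Om; set p := sup _; set F := sup _; set a : R := 2 ^+ n * F + 1.
have k0 : (0 < k)%N by exact: leq_ltn_trans lk.
have cO : compact (closure Om) by exact: compact_closure_bounded.
have subO : Om `<=` closure Om by exact: subset_closure.
have clO x : closure Om x -> Om x \/ boundary Om x.
  move=> cx; have [|nx] := pselect (Om x); [by left|right; split=> //].
  by move/interior_subset.
have fF x : Om x -> f x <= F by exact: le_sup_image_compact cO cf subO.
have F0 : 0 <= F by rewrite (le_trans _ (fF _ Oc))// ltW// f0//; exact: subO.
have a0 : 0 <= a by rewrite addr_ge0// mulr_ge0// exprn_ge0.
have bsub : boundary Om `<=` closure Om by move=> x [].
have cB : compact (boundary Om).
  apply: (subclosed_compact _ cO) => //.
  rewrite /boundary setDE; apply: closedI; first exact: closed_closure.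
  exact/open_closedC/open_interior.
have phip x : boundary Om x -> `|phi x| <= p.
  move=> bx; apply: (@le_sup_image_compact _ _ _ _ (fun y => `|phi y|) _ cB) => //.
  apply/subspace_continuousP => y By; apply: cvg_norm.
  exact: (subspace_continuousP _ _).1 cphi _ By.
have dd x : closure Om x -> enorm (x - c) <= d.
  by move=> cx; exact: enormB_le_ediam.
have d0 : 0 <= d by apply: le_trans (dd _ (subO _ Oc)); exact: enorm_ge0.
have dd2 x : closure Om x -> edot (x - c) (x - c) <= d ^+ 2.
  by move=> /dd ?; rewrite -enorm_sqr ler_pXn2r// nnegrE ?enorm_ge0.
have [cu _ _] := C1u.
have nO : closure Om !=set0 by exists c; exact: subO.
apply: ge_ereal_sup => _ [x Ox <-]; rewrite lee_fin ler_norml; apply/andP; split.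
- pose q y := a / 2 * edot (y - c) (y - c).
  have cuq : {within closure Om, continuous (u - q)}.
    apply/subspace_continuousP => y By; apply: cvgB.
      exact: (subspace_continuousP _ _).1 cu _ By.
    apply: cvg_within_filter; apply: cvgM; first exact: cvg_cst.
    by apply: edot_cvg; apply: cvgB => //; exact: cvg_cst.
  have [y] := compact_EVT_min nO cO cuq; rewrite inE => Cy miny.
  have {}miny z : Om z -> u y - q y <= u z - q z.
    by move=> Oz; apply: miny; rewrite inE; exact: subO.
  have By : boundary Om y.
    have [Oy|//] := clO _ Cy; exfalso.
    apply: (no_interior_min l k F Om u y c) miny => //; first by rewrite lk.
      exact: adm.
    by rewrite eqf//; exact: fF.
  have := normal_derivative_le_at_min a _ _ _ _ _ a0 onu C1u By miny.
  rewrite bc//.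
  have [n1 _] := outer_unit_normal_inward _ _ _ onu By.
  have : a * edot (y - c) (nu y) <= a * enorm (y - c).
    by rewrite ler_wpM2l// edot_unit_le.
  have := phip _ By; rewrite ler_norml => /andP[phiy _].
  have := miny _ Ox; rewrite /q.
  have : a * enorm (y - c) <= a * d by rewrite ler_wpM2l// dd.
  have : a / 2 * edot (y - c) (y - c) <= a / 2 * d ^+ 2.
    by rewrite ler_wpM2l ?divr_ge0// dd2.
  have : 0 <= a / 2 * edot (x - c) (x - c) by rewrite mulr_ge0 ?edotxx_ge0// divr_ge0.
  lra.
- have [y] := compact_EVT_max nO cO cu; rewrite inE => Cy maxy.
  have {}maxy z : Om z -> u z <= u y.
    by move=> Oz; apply: maxy; rewrite inE; exact: subO.
  have By : boundary Om y.
    have [Oy|//] := clO _ Cy; exfalso.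
    by apply: (no_interior_max k Om u y) maxy => //; exact: adm.
  have := normal_derivative_ge0_at_max _ _ _ _ onu C1u By maxy.
  rewrite bc//.
  have := phip _ By; rewrite ler_norml => /andP[_ phiy].
  have := maxy _ Ox.
  have : 0 <= a * d + a / 2 * d ^+ 2.
    by rewrite addr_ge0 ?mulr_ge0 ?divr_ge0 ?sqr_ge0.
  lra.
Qed.
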